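(* There exists an absolute constant $C>0$ such that for every $n\ge 3$ and every pair of distinct indices $i,j\in\{1,\dots,n\}$, the transvection $T_{i,j}\in\mathrm{SL}_n(\mathbb Z)$ is represented by the word $\widetilde\tau_{ij}(a,b)$ in the alphabet $\{a^{\pm1},b^{\pm1}\}$ (that is, $\widetilde\tau_{ij}(a_n,b_n)=T_{i,j}$), and $$\ell(\widetilde\tau_{ij})\le Cn^2.$$
   Context: $E_{i,j}$ is the standard $n\times n$ matrix unit, $T_{i,j}=I_n+E_{i,j}$ ($i\neq j$), $[x,y]=x^{-1}y^{-1}xy$, $\varepsilon_n=(-1)^{n-1}$, $$a_n=\sum_{i=1}^{n-1}E_{i,i+1}+\varepsilon_nE_{n,1},\qquad b_n=I_n+E_{2,1}.$$ For a word $w$ in $\{a^{\pm1},b^{\pm1}\}$, $\ell(w)$ is its freely reduced length. Define words in $a,b$ as follows. $\omega_2:=b$, and for $3\le r\le n$, with $m_r:=\lfloor r/2\rfloor+1$ and $d_r:=r-m_r+1=\lceil r/2\rceil$, $$\omega_r:=[\,a^{-(m_r-1)}\omega_{d_r}a^{m_r-1},\ \omega_{m_r}].$$ For $i>j$: $\widetilde\tau_{ij}:=a^{-(j-1)}\omega_{i-j+1}a^{j-1}$. Put $\rho_n:=\bigl(a^{-(n-1)}ba^{n-1}\bigr)^{\varepsilon_n}$ and $\rho_s:=[\rho_n,\widetilde\tau_{ns}]$ for $2\le s\le n-1$. For $i<j$: $\widetilde\tau_{ij}:=a^{-(i-1)}\rho_{j-i+1}a^{i-1}$. *)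

(* Defs.v *)
From HB Require Import structures.
From mathcomp Require Import all_boot all_order all_algebra.
From mathcomp Require Import zify.

Set Implicit Arguments.
Unset Strict Implicit.
Unset Printing Implicit Defensive.

Import Order.TTheory GRing.Theory Num.Theory.

(* The first component selects the generator (false for a, true for b); the
   second component is true for the inverse of that generator. *)
Definition letter := (bool * bool)%type.

Definition letter_inv (l : letter) : letter := (l.1, ~~ l.2).

Lemma letter_invK : involutive letter_inv.
Proof. by case=> g e; rewrite /letter_inv /= negbK. Qed.

(* Words are plain sequences of letters, not elements of the free group. They
   form a *-monoid, so that the group_scope notations x * y, x^-1, x ^+ k,
   x ^- k and [~ x, y] = x^-1 * y^-1 * x * y denote formal operations. *)
Definition word := seq letter.

HB.instance Definition _ := Choice.on word.

Definition word_inv (w : word) : word := rev (map letter_inv w).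

Lemma word_invK : involutive word_inv.
Proof.
by move=> w; rewrite /word_inv map_rev revK mapK //; apply: letter_invK.
Qed.

Lemma word_invM : {morph word_inv : u v / u ++ v >-> v ++ u}.
Proof. by move=> u v; rewrite /word_inv map_cat rev_cat. Qed.

HB.instance Definition _ := isStarMonoid.Build word
  (@catA letter) (@cat0s letter) word_invK word_invM.

Definition wa : word := [:: (false, false)].
Definition wb : word := [:: (true, false)].

Definition push (l : letter) (w : word) : word :=
  if w is l' :: w' then if l' == letter_inv l then w' else l :: w
  else [:: l].

Definition reduce (w : word) : word := foldr push [::] w.

Definition reduced (w : word) : bool :=
  sorted (fun l l' => l' != letter_inv l) w.

Definition len (w : word) : nat := size (reduce w).

Lemma reduce_reduced (w : word) : reduced (reduce w).
Proof.
elim: w => //= l w; case: (reduce w) => //= l' w'.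
case: eqP => [_|/eqP ne] h; first exact: path_sorted h.
by rewrite /= ne.
Qed.

Lemma reduced_reduce (w : word) : reduced w -> reduce w = w.
Proof.
elim: w => //= l w IH h; rewrite (IH (path_sorted h)).
by case: w h {IH} => //= l' w /andP[/negPf-> _].
Qed.

Lemma reduce_cancel (u v : word) (l : letter) :
  reduce (u ++ [:: l, letter_inv l & v]) = reduce (u ++ v).
Proof.
rewrite /reduce !foldr_cat /= -/(reduce v); congr (foldr _ _ u).
have := reduce_reduced v; case: (reduce v) => [|l' w] /=; first by rewrite eqxx.
rewrite letter_invK; case: eqP => [->|_ _] /=; last by rewrite eqxx.
by case: w => //= l'' w /andP[/negPf->].
Qed.

Local Open Scope group_scope.

Definition letter_eval (G : groupType) (x y : G) (l : letter) : G :=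
  let g := if l.1 then y else x in if l.2 then g^-1 else g.

Definition word_eval (G : groupType) (x y : G) (w : word) : G :=
  \prod_(l <- w) letter_eval x y l.

Definition wexpz (w : word) (z : int) : word :=
  match z with Posz k => w ^+ k | Negz k => w ^- k.+1 end.

Definition eps (n : nat) : int := ((-1) ^+ n.-1)%R.

Definition m_ (r : nat) : nat := (r %/ 2).+1.
Definition d_ (r : nat) : nat := (r - m_ r).+1.

Lemma d_uphalf (r : nat) : 3 <= r -> d_ r = uphalf r.
Proof. rewrite /d_ /m_; lia. Qed.

(* The recursion is on a fuel argument k; r is always enough fuel, see omegaE. *)
Fixpoint omega_rec (k r : nat) : word :=
  if k is k'.+1 then
    if r <= 2 then wb
    else [~ wa ^- (m_ r).-1 * omega_rec k' (d_ r) * wa ^+ (m_ r).-1,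
            omega_rec k' (m_ r)]
  else wb.

Definition omega (r : nat) : word := omega_rec r r.

Lemma omega2 : omega 2 = wb.
Proof. by []. Qed.

Lemma omega_recE (k r : nat) : r <= k -> omega_rec k r = omega r.
Proof.
suff H N : forall k k' r, r <= N -> r <= k -> r <= k' ->
    omega_rec k r = omega_rec k' r by move=> rk; apply: (H r).
elim: N => [|N IH] {}k k' {}r.
  by rewrite leqn0 => /eqP-> _ _; case: k k' => [|k] [|k'].
case: k k' => [|k] [|k'] rN; rewrite ?leqn0 //=.
- by move=> /eqP->.
- by move=> _ /eqP->.
move=> rk rk'; case: leqP => // r2.
by congr [~ _ * _ * _, _]; apply: IH; rewrite /d_ /m_; lia.
Qed.

Lemma omegaE (r : nat) : 3 <= r ->
  omega r = [~ wa ^- (m_ r).-1 * omega (d_ r) * wa ^+ (m_ r).-1, omega (m_ r)].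
Proof.
case: r => // r r3; rewrite {1}/omega [omega_rec _ _]/=.
by rewrite leqNgt r3 /= !omega_recE // /d_ /m_; lia.
Qed.

Definition tau_low (i j : nat) : word :=
  wa ^- j.-1 * omega (i - j).+1 * wa ^+ j.-1.

Definition rho_top (n : nat) : word :=
  wexpz (wa ^- n.-1 * wb * wa ^+ n.-1) (eps n).

Definition rho (n s : nat) : word :=
  if s == n then rho_top n else [~ rho_top n, tau_low n s].

(* Indices are 1-based; the value for i = j is irrelevant. *)
Definition tau (n i j : nat) : word :=
  if j < i then tau_low i j
  else wa ^- i.-1 * rho n (j - i).+1 * wa ^+ i.-1.

Local Close Scope group_scope.

Local Open Scope ring_scope.

Record SL (n : nat) := MkSL {
  SLval :> 'M[int]_n;
  SL_det : \det SLval == 1 }.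

HB.instance Definition _ (n : nat) := [isSub for @SLval n].
HB.instance Definition _ (n : nat) := [Choice of SL n by <:].

Section SLGroup.
Variable n : nat.
Implicit Types A B C : SL n.

Lemma SL_unit A : (A : 'M_n) \in unitmx.
Proof. by rewrite unitmxE (eqP (SL_det A)) unitr1. Qed.

Fact SL_one_det : \det (1%:M : 'M[int]_n) == 1.
Proof. by rewrite det1. Qed.
Fact SL_mul_det A B : \det ((A : 'M_n) *m B) == 1.
Proof. by rewrite det_mulmx (eqP (SL_det A)) (eqP (SL_det B)) mulr1. Qed.
Fact SL_inv_det A : \det (invmx (A : 'M_n)) == 1.
Proof. by rewrite det_inv (eqP (SL_det A)) invr1. Qed.

Definition SL_one : SL n := MkSL SL_one_det.
Definition SL_mul A B : SL n := MkSL (SL_mul_det A B).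
Definition SL_inv A : SL n := MkSL (SL_inv_det A).

Fact SL_mulA : associative SL_mul.
Proof. by move=> A B C; apply/val_inj; rewrite /= mulmxA. Qed.
Fact SL_mul1 : left_id SL_one SL_mul.
Proof. by move=> A; apply/val_inj; rewrite /= mul1mx. Qed.
Fact SL_mulr1 : right_id SL_one SL_mul.
Proof. by move=> A; apply/val_inj; rewrite /= mulmx1. Qed.
Fact SL_mulV : left_inverse SL_one SL_inv SL_mul.
Proof. by move=> A; apply/val_inj; rewrite /= mulVmx // SL_unit. Qed.
Fact SL_mulrV : right_inverse SL_one SL_inv SL_mul.
Proof. by move=> A; apply/val_inj; rewrite /= mulmxV // SL_unit. Qed.

HB.instance Definition _ := isGroup.Build (SL n)
  SL_mulA SL_mul1 SL_mulr1 SL_mulV SL_mulrV.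

End SLGroup.

(* The matrix unit with 1-based indices, see EE; it is 0 if i or j is not in
   {1, ..., n}. *)
Definition E (n i j : nat) : 'M[int]_n :=
  \matrix_(k < n, l < n) ((k.+1 == i) && (l.+1 == j))%:R.

Lemma EE (n : nat) (i j : 'I_n) : E n i.+1 j.+1 = delta_mx i j.
Proof. by apply/matrixP=> k l; rewrite !mxE !eqSS. Qed.

Definition T (n i j : nat) : 'M[int]_n := 1%:M + E n i j.

Definition a_mx (n : nat) : 'M[int]_n :=
  \sum_(1 <= i < n) E n i i.+1 + eps n *: E n n 1.

Definition b_mx (n : nat) : 'M[int]_n := 1%:M + E n 2 1.

Lemma a_mxE (n : nat) (k l : 'I_n) :
  a_mx n k l = (l == k.+1 :> nat)%:R
             + eps n * ((k.+1 == n) && (l == 0 :> nat))%:R.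
Proof.
rewrite !mxE summxE eqSS; congr (_ + _).
have [lk|nlk] := eqVneq (l : nat) k.+1; last first.
  rewrite big1_seq // => i _; rewrite mxE eqSS.
  by case: eqP => //= <-; rewrite (negPf nlk).
rewrite (@big_cat_nat _ _ _ k.+1) //=.
rewrite big_nat big1 ?add0r; last first.
  by move=> i /andP[_ ik]; rewrite mxE gtn_eqF.
rewrite big_ltn; last by rewrite -lk.
rewrite mxE lk !eqxx /= big_nat big1 ?addr0 // => i /andP[ki _].
by rewrite mxE ltn_eqF.
Qed.

Fact a_mx_det (n : nat) : \det (a_mx n) == 1.
Proof.
case: n => [|n]; first by rewrite det_mx00.
rewrite (expand_det_col _ ord0) (bigD1 ord_max) //= big1 ?addr0; last first.
  move=> k nk; rewrite a_mxE /= eqSS add0r.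
  by move: nk; rewrite -val_eqE /= => /negPf->; rewrite mulr0 mul0r.
rewrite a_mxE /= !eqxx add0r mulr1 /cofactor addn0 mulrA /eps /= -exprD.
suff -> : row' ord_max (col' ord0 (a_mx n.+1)) = 1%:M.
  by rewrite det1 mulr1 addnn -mul2n exprM sqrrN !expr1n.
apply/matrixP=> k l; rewrite mxE mxE a_mxE mxE lift_max lift0 eqSS.
by rewrite andbF mulr0 addr0 eq_sym.
Qed.

Fact b_mx_det (n : nat) : \det (b_mx n) == 1.
Proof.
rewrite det_trig; last first.
  apply/is_trig_mxP => k l kl; rewrite !mxE -val_eqE /= (ltn_eqF kl) add0r.
  by case: eqP => //= -[k1]; case: eqP => // -[l0]; rewrite l0 in kl.
by rewrite big1 // => k _; rewrite !mxE eqxx; case: (k : nat) => [|[]].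
Qed.

Definition a_SL (n : nat) : SL n := MkSL (a_mx_det n).
Definition b_SL (n : nat) : SL n := MkSL (b_mx_det n).

(* Main.v *)
Require Import Defs.
From mathcomp Require Import all_boot all_order all_algebra.
From mathcomp Require Import zify.

(** The generator [a_n] is a signed cyclic shift: conjugation by it sends the
    matrix unit [E_(i,j)] to [E_(i+1,j+1)], with a sign [eps n] each time an
    index wraps around from [n] to [1] ([E_mul_a], [a_mul_E] and the two [last]
    variants).  So from one transvection per diagonal all the others on that
    diagonal are obtained by conjugating with powers of [a]
    ([eval_shift]).  The diagonals themselves are reached by the Steinberg
    relation [[T_(i,k), T_(k,j)] = T_(i,j)] ([val_commg]).

    Below the diagonal, [T_(r,1)] is the commutator of [T_(r,m)] and [T_(m,1)]
    with [m] about [r/2]; as [T_(r,m)] is a shift of [T_(d,1)] with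
    [d = r - m + 1], both factors come from the same problem at half the size
    ([eval_omega]).  Above the diagonal, shifting [b = T_(2,1)] by [n-1] places
    makes the row index wrap once and gives [1 + eps n E_(1,n)], whence
    [T_(1,n)] after raising to the power [eps n] ([eval_rho_top]); a single
    commutator with [T_(n,s)] then produces [T_(1,s)] ([eval_rho]).

    For the length, let [L r] be the number of letters of [omega r], before any
    free reduction.  Halving gives [L r = 2 L d + 2 L m + 4 (m - 1)], where
    [d] and [m] are both close to [r/2]: each level of the recursion quadruples
    the number of subwords and halves the size, while the conjugating powers
    of [a] only add a linear term, so [L] is quadratic ([size_omega]).  Every
    [tau] uses at most two copies of some [omega] and [O(n)] further letters,
    and free reduction can only shorten a word ([len_le_size]). *)

Set Implicit Arguments.
Unset Strict Implicit.
Unset Printing Implicit Defensive.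

Import Order.TTheory GRing.Theory Num.Theory.

Local Open Scope ring_scope.

(** * Evaluation of words *)

Section Eval.
Variables (G : groupType) (x y : G).
Local Notation ev := (word_eval x y).

Lemma word_evalM (u v : word) : ev (u * v)%g = (ev u * ev v)%g.
Proof. by rewrite /word_eval big_cat. Qed.

Lemma word_eval_letter (l : letter) : ev [:: l] = letter_eval x y l.
Proof. by rewrite /word_eval big_seq1. Qed.

Lemma word_evalV (u : word) : ev (u^-1)%g = ((ev u)^-1)%g.
Proof.
elim: u => [|l u IH].
  by rewrite /word_eval !big_nil invg1.
have -> : l :: u = (([:: l] : word) * u)%g by [].
have Vl : ev (([:: l] : word)^-1)%g = ((ev [:: l])^-1)%g.
  have -> : (([:: l] : word)^-1)%g = [:: letter_inv l] by [].
  rewrite !word_eval_letter /letter_eval /=.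
  by case: l.2 => //=; rewrite invgK.
by rewrite invgM !word_evalM IH Vl invgM.
Qed.

Lemma word_evalX (u : word) (k : nat) : ev (u ^+ k)%g = (ev u ^+ k)%g.
Proof.
elim: k => [|k IH]; first by rewrite /word_eval big_nil.
by rewrite !expgS word_evalM IH.
Qed.

Lemma word_evalJ (u v : word) : ev (v^-1 * u * v)%g = (ev u ^ ev v)%g.
Proof. by rewrite !word_evalM word_evalV conjgE mulgA. Qed.

Lemma word_evalR (u v : word) : ev [~ u, v]%g = [~ ev u, ev v]%g.
Proof. by rewrite /commg /conjg !(word_evalM, word_evalV). Qed.

End Eval.

(** * Matrix units and the signed cyclic shift *)

Section MatrixUnits.
Variable n : nat.
Local Notation E := (E n).

Lemma mulEE (i j k l : nat) :
  E i j *m E k l = ((j == k) && (0 < j <= n)%N)%:R *: E i l.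
Proof.
apply/matrixP=> p q; rewrite !mxE.
case: (boolP ((j == k) && _)) => [/andP[/eqP <- jn]|nj]; last first.
  rewrite mul0r big1 // => s _; rewrite !mxE.
  case: (eqVneq s.+1 j) => [sj|_]; last by rewrite andbF mul0r.
  case: (eqVneq s.+1 k) => [sk|_]; last by rewrite mulr0.
  by move: nj (ltn_ord s); rewrite -sj -sk eqxx /= => /negPf->.
case: j jn => // j jn; rewrite (bigD1 (Ordinal jn)) //= big1 => [|s].
  rewrite !mxE /= !eqxx andbT /= mul1r addr0 -natrM mulnb.
  by case: (_ == i).
by rewrite -val_eqE /= !mxE eqSS => /negPf->; rewrite andbF mul0r.
Qed.

Lemma mulEE_neq (i j k l : nat) : j <> k -> E i j *m E k l = 0.
Proof. by move/eqP/negPf=> jk; rewrite mulEE jk scale0r. Qed.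

Lemma mulEE_eq (i j l : nat) : (0 < j <= n)%N -> E i j *m E j l = E i l.
Proof. by move=> jn; rewrite mulEE eqxx jn scale1r. Qed.

Lemma E_mul_a (i j : nat) : (0 < j < n)%N -> E i j *m a_mx n = E i j.+1.
Proof.
move=> jn; rewrite /a_mx mulmxDr -scalemxAr mulmx_sumr.
rewrite (bigD1_seq j) ?iota_uniq //=; last by rewrite mem_index_iota.
rewrite big1 => [|k /eqP kj]; last by rewrite mulEE_neq // => /esym.
by rewrite mulEE_eq ?mulEE_neq ?scaler0 ?addr0 //; lia.
Qed.

Lemma E_mul_a_last (i : nat) : (0 < n)%N -> E i n *m a_mx n = eps n *: E i 1.
Proof.
move=> n0; rewrite /a_mx mulmxDr -scalemxAr mulmx_sumr.
rewrite big_nat big1 => [|k kn]; last by rewrite mulEE_neq //; lia.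
by rewrite mulEE_eq ?add0r //; lia.
Qed.

Lemma a_mul_E (i j : nat) : (0 < i < n)%N -> a_mx n *m E i.+1 j = E i j.
Proof.
move=> jn; rewrite /a_mx mulmxDl -scalemxAl mulmx_suml.
rewrite (bigD1_seq i) ?iota_uniq //=; last by rewrite mem_index_iota.
rewrite big1 => [|k /eqP kj]; last by rewrite mulEE_neq //; lia.
by rewrite mulEE_eq ?mulEE_neq ?scaler0 ?addr0 //; lia.
Qed.

Lemma a_mul_E_last (j : nat) : (0 < n)%N -> a_mx n *m E 1 j = eps n *: E n j.
Proof.
move=> n0; rewrite /a_mx mulmxDl -scalemxAl mulmx_suml.
rewrite big_nat big1 => [|k kn]; last by rewrite mulEE_neq //; lia.
by rewrite mulEE_eq ?add0r //; lia.
Qed.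

End MatrixUnits.

(** * Conjugates and commutators of transvections *)

Section Transvections.
Variable n : nat.
Implicit Types x y : SL n.

Lemma val_mulg x y : SLval (x * y)%g = SLval x *m SLval y.
Proof. by []. Qed.

Lemma val_conjg x y (X Y : 'M[int]_n) :
  SLval x = 1%:M + X -> X *m SLval y = SLval y *m Y ->
  SLval (x ^ y)%g = 1%:M + Y.
Proof.
move=> xX XY; apply: (can_inj (mulKmx (SL_unit y))).
rewrite -val_mulg -conjgC val_mulg xX mulmxDl XY mul1mx.
by rewrite mulmxDr mulmx1.
Qed.

Lemma val_invg x (X : 'M[int]_n) :
  SLval x = 1%:M + X -> X *m X = 0 -> SLval (x^-1)%g = 1%:M - X.
Proof.
move=> xX XX; apply: (can_inj (mulKmx (SL_unit x))).
rewrite -val_mulg mulgV xX mulmxDl mul1mx mulmxBr mulmx1 XX subr0.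
by rewrite subrK.
Qed.

(** The Steinberg relation [[1 + X, 1 + Y] = 1 + X Y], checked in the form
    [x y = y x [x, y]], which involves no inverse. *)
Lemma val_commg x y (X Y : 'M[int]_n) :
  SLval x = 1%:M + X -> SLval y = 1%:M + Y ->
  X *m X = 0 -> Y *m X = 0 ->
  SLval [~ x, y]%g = 1%:M + X *m Y.
Proof.
move=> xX yY XX YX; apply: (can_inj (mulKmx (SL_unit (y * x)%g))).
rewrite -val_mulg -commgC !val_mulg xX yY.
have yx : (1%:M + Y) *m (1%:M + X) = 1%:M + (X + Y).
  by rewrite mulmxDl mul1mx mulmxDr mulmx1 YX addr0 addrA.
rewrite yx mulmxDl mul1mx mulmxDr mulmx1 [RHS]mulmxDr mulmx1.
rewrite [_ *m (X *m Y)]mulmxDl mul1mx mulmxDl !mulmxA XX YX !mul0mx !addr0.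
by rewrite -!addrA; congr (_ + _); rewrite addrCA.
Qed.

Lemma commg_T x y (i k j : nat) :
    (0 < k <= n)%N -> i <> k -> i <> j ->
    SLval x = T n i k -> SLval y = T n k j ->
  SLval [~ x, y]%g = T n i j.
Proof.
move=> kn ik ij xT yT; rewrite (val_commg xT yT) ?mulEE_eq //.
  by rewrite mulEE_neq // => /esym.
by rewrite mulEE_neq // => /esym.
Qed.

Lemma conjg_a_T x (i j k : nat) :
    (0 < i)%N -> (0 < j)%N -> (i + k <= n)%N -> (j + k <= n)%N ->
    SLval x = T n i j ->
  SLval (x ^ (a_SL n ^+ k))%g = T n (i + k) (j + k).
Proof.
move=> i0 j0; elim: k => [|k IH] ik jk xT; first by rewrite conjg1 !addn0.
rewrite expgSr conjgM !addnS.
apply: (val_conjg (IH ltac:(lia) ltac:(lia) xT)).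
by rewrite E_mul_a ?a_mul_E //; lia.
Qed.

End Transvections.

(** * The words evaluate to transvections *)

Section Values.
Variable n : nat.
Local Notation ev := (word_eval (a_SL n) (b_SL n)).

Lemma eval_wa : ev wa = a_SL n. Proof. exact: word_eval_letter. Qed.

Lemma eval_wb : ev wb = b_SL n. Proof. exact: word_eval_letter. Qed.

Lemma eval_shift (w : word) (i j k : nat) :
    (0 < i)%N -> (0 < j)%N -> (i + k <= n)%N -> (j + k <= n)%N ->
    SLval (ev w) = T n i j ->
  SLval (ev (wa ^- k * w * wa ^+ k)%g) = T n (i + k) (j + k).
Proof. by rewrite word_evalJ word_evalX eval_wa; apply: conjg_a_T. Qed.

Lemma eval_omega (r : nat) :
  (2 <= r <= n)%N -> SLval (ev (omega r)) = T n r 1.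
Proof.
elim/ltn_ind: r => r IH /andP[r2 rn].
have [r3|r3] := ltnP 2 r; last first.
  have -> : r = 2 by lia.
  by rewrite omega2 eval_wb.
rewrite omegaE // word_evalR.
have mr : (2 <= m_ r < r)%N by rewrite /m_; lia.
have dr : (2 <= d_ r < r)%N by rewrite /d_ /m_; lia.
have dm : (d_ r + (m_ r).-1 = r)%N by rewrite /d_ /m_; lia.
have Hm : SLval (ev (omega (m_ r))) = T n (m_ r) 1 by apply: IH; lia.
have Hd : SLval (ev (omega (d_ r))) = T n (d_ r) 1 by apply: IH; lia.
apply: commg_T Hm; try lia.
have m1 : (1 + (m_ r).-1 = m_ r)%N by lia.
by rewrite (@eval_shift _ (d_ r) 1) ?dm ?m1 //; lia.
Qed.

Lemma eval_tau_low (i j : nat) :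
  (0 < j < i)%N -> (i <= n)%N -> SLval (ev (tau_low i j)) = T n i j.
Proof.
move=> ji ni; rewrite /tau_low.
rewrite (@eval_shift _ (i - j).+1 1) ?eval_omega //; try lia.
by congr (T n _ _); lia.
Qed.

(** After [n-2] shifts [T_(2,1)] has become [T_(n,n-1)]; in the last shift only
    the row index wraps around, hence the sign [eps n], which the outer
    exponent undoes. *)
Lemma eval_rho_top : (2 <= n)%N -> SLval (ev (rho_top n)) = T n 1 n.
Proof.
move=> n2; rewrite /rho_top.
set w := (wa ^- n.-1 * wb * wa ^+ n.-1)%g.
have epsV : eps n * eps n = 1 by rewrite /eps -expr2 sqrr_sign.
have wE : SLval (ev w) = 1%:M + eps n *: E n 1 n.
  rewrite /w word_evalJ word_evalX eval_wa eval_wb.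
  have -> : n.-1 = n.-2.+1 by lia.
  rewrite expgSr conjgM.
  have shifted :
      SLval (b_SL n ^ (a_SL n ^+ n.-2))%g = T n (2 + n.-2) (1 + n.-2).
    by apply: conjg_a_T => //; lia.
  apply: (val_conjg shifted).
  rewrite E_mul_a; last by lia.
  rewrite -scalemxAr a_mul_E_last ?scalerA ?epsV ?scale1r; last by lia.
  by congr (Defs.E n _ _); lia.
have nilp : (eps n *: E n 1 n) *m (eps n *: E n 1 n) = 0.
  by rewrite -scalemxAl -scalemxAr mulEE_neq ?scaler0 //; lia.
move: wE nilp epsV; rewrite /eps -signr_odd.
case: (odd n.-1) => /= wE nilp _.
  rewrite expr1 in wE nilp.
  by rewrite word_evalV (val_invg wE nilp) scaleN1r opprK.
by rewrite wE scale1r.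
Qed.

Lemma eval_rho (s : nat) : (2 <= s <= n)%N -> SLval (ev (rho n s)) = T n 1 s.
Proof.
move=> sn; rewrite /rho; case: eqP => [->|s_n].
  by apply: eval_rho_top; lia.
rewrite word_evalR; apply: (@commg_T _ _ _ _ n); try lia.
  by apply: eval_rho_top; lia.
by apply: eval_tau_low; lia.
Qed.

Lemma eval_tau (i j : nat) :
    (1 <= i <= n)%N -> (1 <= j <= n)%N -> i <> j ->
  SLval (ev (tau n i j)) = T n i j.
Proof.
move=> iN jN ij; rewrite /tau; case: ltnP => ji.
  by apply: eval_tau_low; lia.
rewrite (@eval_shift _ 1 (j - i).+1) ?eval_rho //; try lia.
by congr (T n _ _); lia.
Qed.

End Values.

(** * The words have quadratic length *)

Lemma size_push (l : letter) (w : word) : (size (push l w) <= (size w).+1)%N.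
Proof. by case: w => //= l' w; case: eqP => //= _; apply: ltnW. Qed.

Lemma len_le_size (w : word) : (len w <= size w)%N.
Proof.
rewrite /len; elim: w => //= l w IH.
exact: leq_trans (size_push _ _) _.
Qed.

Lemma size_wordM (u v : word) : size (u * v)%g = (size u + size v)%N.
Proof. exact: size_cat. Qed.

Lemma size_wordV (u : word) : size (u^-1)%g = size u.
Proof. by rewrite size_rev size_map. Qed.

Lemma size_wordX (u : word) (k : nat) : size (u ^+ k)%g = (k * size u)%N.
Proof. by elim: k => // k IH; rewrite expgS size_wordM IH mulSn. Qed.

Lemma size_wordJ (w : word) (k : nat) :
  size (wa ^- k * w * wa ^+ k)%g = (size w + k.*2)%N.
Proof. by rewrite !size_wordM size_wordV size_wordX /=; lia. Qed.

Lemma size_wordR (u v : word) : size [~ u, v]%g = ((size u + size v).*2)%N.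
Proof. by rewrite /commg /conjg !(size_wordM, size_wordV); lia. Qed.

Lemma size_wexpz_eps (w : word) (n : nat) : size (wexpz w (eps n)) = size w.
Proof.
rewrite /eps -signr_odd; case: (odd _) => //=.
exact: (size_wordV w).
Qed.

(** The bound is [6 r^2 - 14 r + 5], written without subtraction.  A bound
    [A r^2 + B r + D] passes through the recursion when [B = - 2 A - 2] and
    [3 D <= 2 A + 4]: this linear term absorbs both the conjugating letters
    and the excess of [d + m = r + 1] over [r].  The value at [r = 2] is then
    [D - 4], which must be at least [1], and [A = 6], [D = 5] is the least
    integer solution. *)
Lemma size_omega (r : nat) :
  (2 <= r)%N -> (size (omega r) + 14 * r <= 6 * r ^ 2 + 5)%N.
Proof.
elim/ltn_ind: r => r IH r2.
have [r3|r3] := ltnP 2 r; last first.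
  have -> : r = 2 by lia.
  by rewrite omega2.
rewrite omegaE // size_wordR size_wordJ.
have := IH (m_ r); have := IH (d_ r).
have mE : m_ r = (r %/ 2).+1 by [].
have dE : d_ r = (r - m_ r).+1 by [].
move=> /(_ ltac:(lia) ltac:(lia)) Hd /(_ ltac:(lia) ltac:(lia)) Hm.
move: Hd Hm; have := odd_double_half r; rewrite mE in dE *.
rewrite dE -divn2; set k := (r %/ 2)%N; case: (odd r) => rE.
  have -> : (r - k.+1).+1 = k.+1 by lia.
  rewrite -rE; lia.
have -> : (r - k.+1).+1 = k by lia.
rewrite -rE; lia.
Qed.

Lemma size_tau_low (n i j : nat) :
  (0 < j < i)%N -> (i <= n)%N -> (size (tau_low i j) <= 6 * n ^ 2)%N.
Proof.
move=> ji ni; rewrite size_wordJ.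
have := @size_omega (i - j).+1 ltac:(lia).
have : ((i - j).+1 <= n)%N by lia.
have : (j <= n)%N by lia.
nia.
Qed.

Lemma size_rho_top (n : nat) : (0 < n)%N -> (size (rho_top n) < n.*2)%N.
Proof. by move=> n0; rewrite size_wexpz_eps size_wordJ /=; lia. Qed.

Lemma size_rho (n s : nat) :
  (2 <= s <= n)%N -> (size (rho n s) <= 12 * n ^ 2 + 4 * n)%N.
Proof.
move=> sn; have := @size_rho_top n ltac:(lia).
rewrite /rho; case: eqP => [_|s_n] top; first by lia.
have := @size_tau_low n n s ltac:(lia) ltac:(lia).
rewrite size_wordR; lia.
Qed.

Lemma size_tau (n i j : nat) :
    (1 <= i <= n)%N -> (1 <= j <= n)%N -> i <> j ->
  (size (tau n i j) <= 18 * n ^ 2)%N.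
Proof.
move=> iN jN ij; rewrite /tau; case: ltnP => ji.
  by have := @size_tau_low n i j ltac:(lia) ltac:(lia); lia.
rewrite size_wordJ; have := @size_rho n (j - i).+1 ltac:(lia).
nia.
Qed.

Local Close Scope ring_scope.

Theorem theorem3p6 :
  exists C : nat, (0 < C)%N /\
    forall n i j : nat, (3 <= n)%N ->
      (1 <= i <= n)%N -> (1 <= j <= n)%N -> i <> j ->
      SLval (word_eval (a_SL n) (b_SL n) (tau n i j)) = T n i j /\
      (len (tau n i j) <= C * n ^ 2)%N.
Proof.
exists 18; split=> // n i j _ iN jN ij; split; first exact: eval_tau.
exact: leq_trans (len_le_size _) (size_tau iN jN ij).
Qed.
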